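(* Let $1<\alpha<n$ and let $1<t,p<\infty$ satisfy $$\frac{n-1}{n}\cdot\frac1p+\frac1t+\frac{n-\alpha+1}{n}=2.$$ Then for all $f\in L^p(\partial\mathbb{R}^n_+)$ and $g\in L^t(\mathbb{R}^n_+)$ the following sharp inequality holds: $$\int_{\mathbb{R}^n_+}\int_{\partial\mathbb{R}^n_+}\frac{g(x)f(y)}{|x-y|^{n-\alpha}}\,dy\,dx\le C_e(n,\alpha,p)\,\|f\|_{L^p(\partial\mathbb{R}^n_+)}\|g\|_{L^t(\mathbb{R}^n_+)},$$ where $C_e(n,\alpha,p)$ (which is finite and is the best constant in this inequality) is the constant defined in the context.
   Context: $\mathbb{R}^n_+=\{x=(x',x_n): x'\in\mathbb{R}^{n-1},\ x_n>0\}$ and $\partial\mathbb{R}^n_+$ is identified with $\mathbb{R}^{n-1}$. For $x=(x',x_n)\in\mathbb{R}^n_+$ and $y\in\partial\mathbb{R}^n_+$, $|x-y|=\sqrt{|x'-y|^2+x_n^2}$. Put $$E_\alpha f(x)=\int_{\partial\mathbb{R}^n_+}\frac{f(y)}{|x-y|^{n-\alpha}}\,dy,\qquad x\in\mathbb{R}^n_+,$$ and $$C_e(n,\alpha,p)=\sup\{\|E_\alpha f\|_{L^q(\mathbb{R}^n_+)}:\ \|f\|_{L^p(\partial\mathbb{R}^n_+)}=1\},\qquad \frac1q=\frac{n-1}{n}\Big(\frac1p-\frac{\alpha-1}{n-1}\Big).$$ *)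

(* Defs.v *)
From HB Require Import structures.
From mathcomp Require Import all_boot all_order all_algebra.
From mathcomp Require Import all_classical all_reals all_analysis.

Set Implicit Arguments.
Unset Strict Implicit.
Unset Printing Implicit Defensive.
Import Order.TTheory GRing.Theory Num.Theory.
Import numFieldNormedType.Exports.

Local Open Scope classical_set_scope.
Local Open Scope ring_scope.

(* The library's sigma-finiteness instance on [m1 \x m2] is shadowed by the one
   for products of subprobabilities, so it cannot be inferred. *)
Lemma sigma_finite_product d1 d2 (T1 : measurableType d1)
    (T2 : measurableType d2) (R : realType)
    (m1 : {sigma_finite_measure set T1 -> \bar R})
    (m2 : {sigma_finite_measure set T2 -> \bar R}) :
  sigma_finite setT (m1 \x m2)%E.
Proof.
have /sigma_finiteP[F [TF ndF Foo]] := sigma_finiteT m1.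
have /sigma_finiteP[G [TG ndG Goo]] := sigma_finiteT m2.
exists (fun k => F k `*` G k) => [|k].
  rewrite -setXTT TF TG predeqE => -[x y]; split.
    move=> [/= [i _ Fix] [j _ Gjy]]; exists (maxn i j) => //; split.
    - by move: x Fix; exact/subsetPset/ndF/leq_maxl.
    - by move: y Gjy; exact/subsetPset/ndG/leq_maxr.
  by move=> [i _ []/= ? ?]; split; exists i.
have [? ?] := Foo k; have [? ?] := Goo k; split; first exact: measurableX.
by rewrite product_measure1E// lte_mul_pinfty// ge0_fin_numE.
Qed.

Section lebesgue_tuple.
Context {R : realType}.
Local Open Scope ereal_scope.

(* [lebesgue_measure] lives on [measurableTypeR R]; this is the same function
   on the canonical (and definitionally equal) sigma-algebra of [R], so that it
   can be combined with [m.-tuple R]. *)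
Definition lebesgueR : set R -> \bar R := @lebesgue_measure R.

Let lebesgueR0 : lebesgueR set0 = 0.
Proof. exact: (measure0 (@lebesgue_measure R)). Qed.

Let lebesgueR_ge0 A : 0 <= lebesgueR A.
Proof. exact: (measure_ge0 (@lebesgue_measure R)). Qed.

Let lebesgueR_sigma_additive : semi_sigma_additive lebesgueR.
Proof. exact: (@measure_semi_sigma_additive _ _ _ (@lebesgue_measure R)). Qed.

HB.instance Definition _ := isMeasure.Build _ _ _ lebesgueR
  lebesgueR0 lebesgueR_ge0 lebesgueR_sigma_additive.

Let lebesgueR_sigma_finite : sigma_finite setT lebesgueR.
Proof. exact: (sigma_finiteT (@lebesgue_measure R)). Qed.

HB.instance Definition _ := Measure_isSigmaFinite.Build _ _ _ lebesgueR
  lebesgueR_sigma_finite.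

Definition tuple_cons m (z : R * m.-tuple R) : m.+1.-tuple R :=
  [the m.+1.-tuple R of z.1 :: z.2].

Lemma measurable_tuple_cons m : measurable_fun setT (@tuple_cons m).
Proof. exact: measurable_cons. Qed.

Section step.
Variables (m : nat) (mu : {sigma_finite_measure set (m.-tuple R) -> \bar R}).

Definition lebesgue_cons : set (m.+1.-tuple R) -> \bar R :=
  pushforward (lebesgueR \x mu) (@tuple_cons m).

Let lebesgue_cons0 : lebesgue_cons set0 = 0.
Proof. by rewrite /lebesgue_cons /pushforward preimage_set0 measure0. Qed.

Let lebesgue_cons_ge0 A : 0 <= lebesgue_cons A.
Proof. by rewrite /lebesgue_cons /pushforward measure_ge0. Qed.

Let lebesgue_cons_sigma_additive : semi_sigma_additive lebesgue_cons.
Proof.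
move=> F mF tF mUF; rewrite /lebesgue_cons /pushforward preimage_bigcup.
have mp A : measurable A -> measurable (@tuple_cons m @^-1` A).
  by move=> mA; rewrite -[X in measurable X]setTI; exact: measurable_tuple_cons.
apply: measure_semi_sigma_additive.
- by move=> n; exact: mp.
- apply/trivIsetP => /= i j _ _ ij; rewrite -preimage_setI.
  by move/trivIsetP : tF => /(_ _ _ _ _ ij) ->//; rewrite preimage_set0.
- by rewrite -preimage_bigcup; exact: mp.
Qed.

HB.instance Definition _ := isMeasure.Build _ _ _ lebesgue_cons
  lebesgue_cons0 lebesgue_cons_ge0 lebesgue_cons_sigma_additive.

Let uncons (s : m.+1.-tuple R) : R * m.-tuple R := (thead s, [tuple of behead s]).

Let measurable_uncons : measurable_fun setT uncons.
Proof.
apply/measurable_fun_pairP; split; first exact: measurable_tnth.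
exact: measurable_behead.
Qed.

Let lebesgue_cons_sigma_finite : sigma_finite setT lebesgue_cons.
Proof.
have [F UF Ffin] : sigma_finite setT (lebesgueR \x mu).
  exact: sigma_finite_product.
exists (fun k => uncons @^-1` F k) => [|k].
  by rewrite -preimage_bigcup -UF preimage_setT.
have [mF Fk] := Ffin k; split.
  by rewrite -[X in measurable X]setTI; exact: measurable_uncons.
rewrite /lebesgue_cons /pushforward (_ : _ @^-1` _ = F k)//.
apply/seteqP; split=> -[x y] /=; rewrite /uncons/= theadE/=;
  by congr (F k (_, _)); apply/val_inj.
Qed.

HB.instance Definition _ := Measure_isSigmaFinite.Build _ _ _ lebesgue_cons
  lebesgue_cons_sigma_finite.

End step.

(* Lebesgue measure on R^m (on its Borel sets) as the m-fold product of the
   one-dimensional Lebesgue measure *)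
Fixpoint lebesgue_tuple (m : nat) :
    {sigma_finite_measure set (m.-tuple R) -> \bar R} :=
  match m return {sigma_finite_measure set (m.-tuple R) -> \bar R} with
  | 0 => \d_ [tuple]
  | m'.+1 => lebesgue_cons (lebesgue_tuple m')
  end.

End lebesgue_tuple.

Section halfspace.
Context {R : realType}.
Local Open Scope ereal_scope.

Definition halfspace m : set (m.-tuple R * R) := [set x | (0 < x.2)%R].
Arguments halfspace m : clear implicits.

Lemma measurable_halfspace m : measurable (halfspace m).
Proof.
rewrite (_ : halfspace m = setT `*` `]0%R, +oo[%classic).
  by apply: measurableX => //; exact: measurable_itv.
by apply/seteqP; split=> x /=; rewrite /halfspace /= in_itv/= andbT// => -[].
Qed.

Definition lebesgue_halfspace m : set (m.-tuple R * R) -> \bar R :=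
  mrestr (lebesgue_tuple m \x lebesgueR) (@measurable_halfspace m).
Arguments lebesgue_halfspace m : clear implicits.

HB.instance Definition _ m := Measure.on (lebesgue_halfspace m).

(* |x - y| for x = (x', x_n) and y = (y, 0) *)
Definition bdist m (x : m.-tuple R * R) (y : m.-tuple R) : R :=
  (Num.sqrt (\sum_(i < m) (tnth x.1 i - tnth y i) ^+ 2 + x.2 ^+ 2))%R.

(* [n] is the dimension of the half space: its points lie in
   R^(n-1) * R and its boundary is R^(n-1). *)
Definition extension (n : nat) (alpha : R) (f : n.-1.-tuple R -> R)
    (x : n.-1.-tuple R * R) : \bar R :=
  \int[lebesgue_tuple n.-1]_y (f y / bdist x y `^ (n%:R - alpha))%:E.

Arguments extension n : clear implicits.

Definition extension_exponent (n : nat) (alpha p : R) : R :=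
  ((n%:R - 1) / n%:R * (p^-1 - (alpha - 1) / (n%:R - 1)))^-1%R.

Definition extension_constant n (alpha p : R) : \bar R :=
  ereal_sup
    [set 'N[lebesgue_halfspace n.-1]_(extension_exponent n alpha p)%:E
           [extension n alpha f]
     | f in [set f : n.-1.-tuple R -> R |
        f \in Lfun (lebesgue_tuple n.-1) p%:E /\
        'N[lebesgue_tuple n.-1]_(p%:E)[EFin \o f] = 1]].

Definition halfspace_form n (alpha : R) (f : n.-1.-tuple R -> R)
    (g : n.-1.-tuple R * R -> R) : \bar R :=
  \int[lebesgue_halfspace n.-1]_x \int[lebesgue_tuple n.-1]_y
    (g x * f y / bdist x y `^ (n%:R - alpha))%:E.

End halfspace.
Arguments halfspace {R} m.
Arguments lebesgue_halfspace {R} m.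
Arguments extension {R} n.
Arguments halfspace_form {R} n.

(* Main.v *)
Require Import Defs.
From HB Require Import structures.
From mathcomp Require Import all_boot all_order all_algebra.
From mathcomp Require Import all_classical all_reals all_analysis.
From mathcomp Require Import measurable_realfun ring lra.
Set Implicit Arguments.
Unset Strict Implicit.
Unset Printing Implicit Defensive.
Import Order.TTheory GRing.Theory Num.Theory.
Import numFieldNormedType.Exports.
Local Open Scope classical_set_scope.
Local Open Scope ring_scope.

(** The condition on the exponents says that the exponent q given by
    1/q = (n-1)/n (1/p - (alpha-1)/(n-1)) is conjugate to t.  Hence, once the
    extension operator E is known to be bounded from L^p of the boundary to L^q
    of the half space, the inequality is Hoelder's inequality combined with the
    homogeneity of Ef in f [potential_form_le_constant], and its constant is
    best because, for each f, Hoelder's inequality is an equality for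
    g = Ef |Ef|^(q-2) [potential_form_norming, potential_constant_le].

    Boundedness of E is a Hardy-Littlewood-Sobolev inequality between a space
    of dimension M = n - 1 and one of dimension N = n, with kernel
    |x - y|^(-lam), lam = n - alpha = M (1 - 1/p) + N (1 - 1/t).  It rests on the
    fact that the sets where |x - y| < r have measure at most A r^N in x and
    A r^M in y.  For nonnegative f and g, the product space is cut into the
    part where g(x) <= f(y)^kap, kap = p N / (t M), and its complement.  In the
    first part y is fixed and, with F = f(y), the integral in x is cut again at
    the distance r = F^(-p/M).  Closer than r, the bound g <= F^kap and
    the integrability of |x - y|^(-lam) near 0 (lam < N) are used; farther than
    r, Young's inequality separates g^t from |x - y|^(-lam t'), which is
    integrable at infinity because lam t' > N, where t' = t / (t - 1).
    The value of kap is the one for which all these contributions are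
    multiples of F^(p-1) [truncated_potential_le].  Integrating against f gives
    int f^p (C + int g^t).  The complement is the mirror image: exchanging
    (f, p, M) and (g, t, N) replaces kap by 1 / kap.

    The resulting estimate [bilinear_potential_le] is not homogeneous, but it
    is enough: it shows at once that the double integral converges absolutely,
    and, tested against truncations of (E|f|)^(q-1), it bounds the L^q norm of
    Ef uniformly over the unit sphere of L^p [Lq_bound_of_duality]. *)

(** * Measurability of sublevel sets and powers *)

Section measurability.
Context d {T : measurableType d} {R : realType}.
Implicit Types f g : T -> R.

Lemma measurable_set_le f g : measurable_fun setT f -> measurable_fun setT g ->
  measurable [set x | f x <= g x].
Proof.
move=> mf mg.
have /(_ measurableT [set true]) := measurable_fun_ler mf mg.
by rewrite setTI; apply.
Qed.

Lemma measurable_set_lt f g : measurable_fun setT f -> measurable_fun setT g ->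
  measurable [set x | f x < g x].
Proof.
move=> mf mg.
have /(_ measurableT [set true]) := measurable_fun_ltr mf mg.
by rewrite setTI; apply.
Qed.

Lemma measurable_fun_powR f (r : R) : measurable_fun setT f ->
  measurable_fun setT (fun x => f x `^ r).
Proof. by move=> mf; exact: (measurableT_comp (measurable_powR r) mf). Qed.

End measurability.

(** * Integrals of powers of a distance *)

Section shells.
Context d {T : measurableType d} {R : realType}.
Variable mu : {measure set T -> \bar R}.
Local Open Scope ereal_scope.

Definition ball_growth (A N : R) (dist : T -> R) :=
  forall r, (0 < r)%R -> mu [set x | (dist x < r)%R] <= (A * r `^ N)%:E.

(** The set S is covered by the shells r b^k u <= dist < r b^k v.  On each of
    them the integrand is at most (r b^k u)^(-s) and the measure at most
    A (r b^k v)^N, so the contributions form a geometric series of ratio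
    b^(N - s).  The case b < 1 serves near the centre and b > 1 at infinity. *)
Lemma integral_shells (A N s b u v : R) : (0 <= A)%R -> (0 < s)%R ->
    (0 < b)%R -> (0 < u)%R -> (0 < v)%R -> (b `^ (N - s) < 1)%R ->
  exists2 C : R, (0 <= C)%R & forall (dist : T -> R) (S : set T) (r : R),
    measurable_fun setT dist -> ball_growth A N dist -> measurable S ->
    (0 < r)%R ->
    (forall x, S x -> (0 < dist x)%R -> exists k : nat,
      (r * b ^+ k * u <= dist x < r * b ^+ k * v)%R) ->
    (forall x, 0 <= dist x)%R ->
  \int[mu]_(x in S) (dist x `^ (- s))%:E <= (C * r `^ (N - s))%:E.
Proof.
move=> A0 s0 b0 u0 v0 th1; set th := (b `^ (N - s))%R in th1 *.
have th0 : (0 < th)%R by exact: powR_gt0.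
pose c := (A * u `^ (- s) * v `^ N)%R.
have c0 : (0 <= c)%R by rewrite !mulr_ge0 ?powR_ge0.
exists (c / (1 - th))%R => [|dist S r mdist grow mS r0 shell dist0].
  by rewrite divr_ge0// subr_ge0 ltW.
pose B k := [set x | (dist x < r * b ^+ k * v)%R].
have mB k : measurable (B k) by exact: measurable_set_lt.
pose a k := ((r * b ^+ k * u) `^ (- s))%R.
apply: (@le_trans _ _ (\int[mu]_(x in S)
    \sum_(0 <= k <oo) (a k * \1_(B k) x)%:E)).
  apply: ge0_le_integral => //.
  - by move=> x _; rewrite lee_fin powR_ge0.
  - by apply/measurable_EFinP/measurable_funTS; exact: measurable_fun_powR.
  - apply: ge0_emeasurable_sum => k.
      by move=> x _ _; rewrite lee_fin mulr_ge0 ?powR_ge0.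
    move=> _; apply/measurable_EFinP; apply: measurable_funM => //.
  - move=> x Sx.
    have F0 n : 0 <= (a n * \1_(B n) x)%:E by rewrite lee_fin mulr_ge0 ?powR_ge0.
    (* at distance 0 the integrand is 0, the value of a power of 0 *)
    have [dx0|dx0] := leP (dist x) 0%R.
      have -> : dist x = 0%R by apply/eqP; rewrite eq_le dx0 dist0.
      by rewrite powR0 ?oppr_eq0 ?gt_eqF// nneseries_ge0.
    have [k /andP[ku kv]] := shell _ Sx dx0.
    apply: le_trans (nneseries_lim_ge k.+1 (fun n _ _ => F0 n)).
    rewrite big_nat_recr//= -[leLHS]add0e leeD//.
      by apply: sume_ge0 => i _; exact: F0.
    have rk0 : (0 < r * b ^+ k * u)%R by rewrite !mulr_gt0// exprn_gt0.
    rewrite lee_fin indicE mem_set// mulr1 /a !powRN lef_pV2 ?posrE ?powR_gt0//.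
    by apply: ge0_ler_powR; rewrite ?nnegrE// ltW.
rewrite integral_nneseries//; last 2 first.
- move=> k; apply/measurable_EFinP; apply: measurable_funM => //.
- by move=> k x _; rewrite lee_fin mulr_ge0 ?powR_ge0.
have bk k : ((b ^+ k) `^ (- s) * (b ^+ k) `^ N = th ^+ k)%R.
  rewrite -!powR_mulrn ?(ltW b0) ?(ltW th0)// -!powRrM /th -powRD; last first.
    by apply/implyP => _; rewrite gt_eqF.
  by congr (_ `^ _)%R; ring.
apply: (@le_trans _ _ (\sum_(0 <= k <oo)
   (c * r `^ (N - s) * th ^+ k)%:E)).
  apply: lee_nneseries => k _; first by
    move=> _; apply: integral_ge0 => x _; rewrite lee_fin mulr_ge0 ?powR_ge0.
  under eq_integral do rewrite EFinM.
  rewrite ge0_integralZl_EFin//; last 2 first.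
  - by apply/measurable_EFinP.
  - exact: powR_ge0.
  rewrite integral_indic//.
  apply: (@le_trans _ _ ((a k)%:E * (A * (r * b ^+ k * v) `^ N)%:E)).
    rewrite lee_wpmul2l ?lee_fin ?powR_ge0//.
    apply: le_trans (grow _ _); last by rewrite !mulr_gt0// exprn_gt0.
    by apply: le_measure; rewrite ?inE//; [exact: measurableI|exact: mB].
  rewrite -EFinM lee_fin /a !powRM ?mulr_ge0 ?exprn_ge0 ?(ltW r0) ?(ltW b0)
    ?(ltW u0) ?(ltW v0)//.
  rewrite /c -bk (addrC N) powRD; last by apply/implyP => _; rewrite gt_eqF.
  by rewrite le_eqVlt; apply/orP; left; apply/eqP; rewrite /c; ring.
rewrite [(c / _ * _)%R]mulrAC.
set z := (c * _)%R; apply: lime_le.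
  by apply: is_cvg_nneseries => k _ _; rewrite lee_fin !mulr_ge0 ?powR_ge0 ?exprn_ge0// ltW.
apply: nearW => n /=; rewrite sumEFin lee_fin.
rewrite -[leLHS]/(series (geometric z th) n) geometric_seriesE ?lt_eqF//.
rewrite ler_wpM2r//; first by rewrite invr_ge0 subr_ge0 ltW.
rewrite ler_piMr ?mulr_ge0 ?powR_ge0//.
by rewrite gerBl exprn_ge0// ltW.
Qed.

End shells.

Lemma dyadic_bracket {R : realType} (a : R) : 1 <= a ->
  exists k : nat, 2 ^+ k <= a < 2 ^+ k.+1.
Proof.
move=> a1; have a0 : 0 <= a by rewrite (le_trans _ a1).
have ex : exists k : nat, a < 2 ^+ k.
  exists (Num.bound a); apply: lt_le_trans (archi_boundP a0) _.
  by rewrite -natrX ler_nat ltnW// ltn_expl.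
case: (ex_minnP ex) => -[|k] ak kmin; first by move: ak; rewrite expr0 ltNge a1.
exists k; rewrite ak andbT leNgt; apply/negP => /kmin.
by rewrite ltnn.
Qed.

Section radial_integrals.
Context d {T : measurableType d} {R : realType}.
Variable mu : {measure set T -> \bar R}.
Local Open Scope ereal_scope.

(** Shells that halve, r 2^(-k) / 2 <= dist < 2 r 2^(-k).  They overlap, so that
    [dyadic_bracket] applies to r / dist with its half-open intervals. *)
Lemma inner_integral (A N s : R) : (0 <= A)%R -> (0 < s)%R -> (s < N)%R ->
  exists2 C : R, (0 <= C)%R & forall (dist : T -> R) (r : R),
    measurable_fun setT dist -> (forall x, 0 <= dist x)%R ->
    ball_growth mu A N dist -> (0 < r)%R ->
  \int[mu]_(x in [set x | (dist x < r)%R]) (dist x `^ (- s))%:E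
    <= (C * r `^ (N - s))%:E.
Proof.
move=> A0 s0 sN; have b0 : (0 < 2^-1 :> R)%R by [].
have th1 : (2^-1 `^ (N - s) < 1 :> R)%R.
  rewrite [ltRHS](_ : _ = 1 `^ (N - s))%R; last by rewrite powR1.
  by apply: gt0_ltr_powR; rewrite ?nnegrE ?subr_gt0//; lra.
have [C C0 CP] := integral_shells mu A0 s0 b0 b0 (ltr0Sn R 1) th1.
exists C => // dist r mdist dist0 grow r0; apply: CP => //.
  exact: measurable_set_lt.
move=> x /= dr d0.
have /dyadic_bracket[k /andP[k1 k2]] : (1 <= r / dist x)%R.
  by rewrite ler_pdivlMr// mul1r ltW.
have k0 : (0 < 2 ^+ k :> R)%R by rewrite exprn_gt0.
exists k; rewrite ler_pdivlMr// in k1; rewrite ltr_pdivrMr// exprS in k2.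
rewrite exprVn; apply/andP; split.
  by rewrite ler_pdivrMr// ler_pdivrMr// ltW//; nra.
by rewrite mulrAC ltr_pdivlMr//; nra.
Qed.

Lemma outer_integral (A N s : R) : (0 <= A)%R -> (0 <= N)%R -> (N < s)%R ->
  exists2 C : R, (0 <= C)%R & forall (dist : T -> R) (r : R),
    measurable_fun setT dist -> (forall x, 0 <= dist x)%R ->
    ball_growth mu A N dist -> (0 < r)%R ->
  \int[mu]_(x in [set x | (r <= dist x)%R]) (dist x `^ (- s))%:E
    <= (C * r `^ (N - s))%:E.
Proof.
move=> A0 N0 Ns; have s0 : (0 < s)%R by exact: le_lt_trans Ns.
have b0 : (0 < 2 :> R)%R by [].
have th1 : (2 `^ (N - s) < 1 :> R)%R.
  rewrite -opprB powRN invf_lt1 ?powR_gt0//.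
  rewrite [ltLHS](_ : _ = 1 `^ (s - N))%R; last by rewrite powR1.
  by apply: gt0_ltr_powR; rewrite ?nnegrE ?subr_gt0// ltr1n.
have [C C0 CP] := integral_shells mu A0 s0 b0 (@ltr01 R) (ltr0Sn R 1) th1.
exists C => // dist r mdist dist0 grow r0; apply: CP => //.
  exact: measurable_set_le.
move=> x /= dr d0.
have /dyadic_bracket[k /andP[k1 k2]] : (1 <= dist x / r)%R.
  by rewrite ler_pdivlMr// mul1r.
exists k; rewrite ler_pdivlMr// in k1; rewrite ltr_pdivrMr// exprSr in k2.
by rewrite mulr1 (mulrC r) k1/= mulrAC.
Qed.

End radial_integrals.

(** * The potential of a truncated function *)

Section truncated_potential.
Context d {T : measurableType d} {R : realType}.
Variable mu : {measure set T -> \bar R}.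
Local Open Scope ereal_scope.

(** The half of the bilinear estimate in which one function dominates the other:
    F stands for the value f(y) at a fixed point y, and the power of F on the
    right is the one that, multiplied by f(y), gives f(y)^p. *)
Lemma truncated_potential_le (A N M lam t p : R) :
    (0 <= A)%R -> (0 < N)%R -> (0 < M)%R -> (0 < lam)%R -> (lam < N)%R ->
    (1 < t)%R -> (1 < p)%R ->
    lam = (M * (1 - p^-1) + N * (1 - t^-1))%R ->
  exists2 C : R, (0 <= C)%R & forall (dist g : T -> R) (F : R),
    measurable_fun setT dist -> (forall x, 0 <= dist x)%R ->
    ball_growth mu A N dist ->
    measurable_fun setT g -> (forall x, 0 <= g x)%R -> (0 < F)%R ->
  \int[mu]_(x in [set x | (g x <= F `^ (p * N / (t * M)))%R])
      (g x * dist x `^ (- lam))%:E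
    <= (F `^ (p - 1))%:E * (C%:E + \int[mu]_x (g x `^ t)%:E).
Proof.
move=> A0 N0 M0 lam0 lamN t1 p1 lamE.
have [t0 p0] : (0 < t)%R /\ (0 < p)%R by split; lra.
have t'0 : (0 < t / (t - 1))%R by rewrite divr_gt0// subr_gt0.
set t' := (t / (t - 1))%R in t'0.
have tt' : (t^-1 + t'^-1 = 1)%R.
  by rewrite /t'; field; rewrite !gt_eqF//= subr_gt0.
have pV1 : (p^-1 < 1)%R by rewrite invf_lt1.
(* lam - N (1 - 1/t) = M (1 - 1/p) > 0, and t' is conjugate to t *)
have Nlam : (N < lam * t')%R.
  rewrite -ltr_pdivrMr// (_ : t'^-1 = 1 - t^-1)%R; last by rewrite -tt' addrAC subrr add0r.
  by rewrite lamE ltrDr mulr_gt0// subr_gt0.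
have [C1 C10 inner] := inner_integral mu A0 lam0 lamN.
have [C2 C20 outer] := outer_integral mu A0 (ltW N0) Nlam.
exists (C1 + C2)%R => [|dist g F mdist dist0 grow mg g0 F0]; first exact: addr_ge0.
set kap := (p * N / (t * M))%R.
(* The radius at which the near and the far part balance. *)
pose r := (F `^ (- (p / M)))%R.
have r0 : (0 < r)%R by exact: powR_gt0.
pose near := [set x | (dist x < r)%R]; pose far := [set x | (r <= dist x)%R].
have mnear : measurable near by exact: measurable_set_lt.
have mfar : measurable far by exact: measurable_set_le.
set S := [set x | _].
have mS : measurable S by exact: measurable_set_le.
have mh : measurable_fun setT (fun x => (g x * dist x `^ (- lam))%:E).
  by apply/measurable_EFinP; apply: measurable_funM => //; exact: measurable_fun_powR.
have -> : S = (S `&` near) `|` (S `&` far).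
  rewrite -setIUr (_ : near `|` far = setT) ?setIT//.
  by apply/seteqP; split=> // x _; rewrite /near /far/=; case: ltP; [left|right].
rewrite ge0_integral_setU//; last 5 first.
- exact: measurableI.
- exact: measurableI.
- exact: measurable_funTS.
- by move=> x _; rewrite lee_fin mulr_ge0// powR_ge0.
- apply/disj_setPS => x [[_ +] [_]]; rewrite /near /far /= => a b.
  by rewrite ltNge b in a.
have near_le : \int[mu]_(x in S `&` near) (g x * dist x `^ (- lam))%:E
    <= (F `^ (p - 1))%:E * C1%:E.
  apply: (@le_trans _ _
      (\int[mu]_(x in S `&` near) ((F `^ kap)%:E * (dist x `^ (- lam))%:E))).
    apply: ge0_le_integral.
    - exact: measurableI.
    - by move=> x _; rewrite lee_fin mulr_ge0// powR_ge0.
    - exact: measurable_funTS.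
    - apply: measurable_funTS; under eq_fun do rewrite -EFinM.
      by apply/measurable_EFinP; apply: measurable_funM => //; exact: measurable_fun_powR.
    - by move=> x [Sx _]; rewrite -EFinM lee_fin ler_wpM2r// powR_ge0.
  apply: (@le_trans _ _
      (\int[mu]_(x in near) ((F `^ kap)%:E * (dist x `^ (- lam))%:E))).
    apply: ge0_subset_integral => //.
    - exact: measurableI.
    - apply: measurable_funTS; under eq_fun do rewrite -EFinM.
      by apply/measurable_EFinP; apply: measurable_funM => //; exact: measurable_fun_powR.
    - by move=> x _; rewrite -EFinM lee_fin mulr_ge0// powR_ge0.
  rewrite ge0_integralZl_EFin//; last 3 first.
  - by move=> x _; rewrite lee_fin powR_ge0.
  - by apply/measurable_funTS/measurable_EFinP; exact: measurable_fun_powR.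
  - exact: powR_ge0.
  apply: (@le_trans _ _ ((F `^ kap)%:E * (C1 * r `^ (N - lam))%:E)).
    by rewrite lee_wpmul2l ?lee_fin ?powR_ge0//; exact: inner.
  rewrite -!EFinM lee_fin mulrCA mulrC ler_wpM2r//.
  rewrite /r -powRrM -powRD; last by apply/implyP => _; rewrite gt_eqF.
  rewrite le_eqVlt; apply/orP; left; apply/eqP; congr (_ `^ _)%R.
  by rewrite /kap lamE; field; rewrite !gt_eqF.
have far_le : \int[mu]_(x in S `&` far) (g x * dist x `^ (- lam))%:E
    <= (F `^ (p - 1))%:E * (C2%:E + \int[mu]_x (g x `^ t)%:E).
  (* The exponent that the weight sg^-1 of Young's inequality contributes,
     since F^e = sg^(-t'). *)
  pose e := (- ((p - 1) / (t - 1)))%R.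
  apply: (@le_trans _ _ (\int[mu]_(x in far)
      ((F `^ (p - 1))%:E * (g x `^ t)%:E
       + (F `^ e)%:E * (dist x `^ (- (lam * t')))%:E))).
    apply: (@le_trans _ _ (\int[mu]_(x in far) (g x * dist x `^ (- lam))%:E)).
      apply: ge0_subset_integral => //.
      - exact: measurableI.
      - exact: measurable_funTS.
      - by move=> x _; rewrite lee_fin mulr_ge0// powR_ge0.
    apply: ge0_le_integral => //.
    - by move=> x _; rewrite lee_fin mulr_ge0// powR_ge0.
    - exact: measurable_funTS.
    - apply: measurable_funTS; under eq_fun do rewrite -!EFinM -EFinD.
      apply/measurable_EFinP; apply: measurable_funD; apply: measurable_funM => //;
        exact: measurable_fun_powR.
    - move=> x _; rewrite -!EFinM -EFinD lee_fin.
      (* The weight is chosen so that the g^t term gets the factor F^(p-1). *)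
      pose sg := (F `^ ((p - 1) / t))%R.
      have sg0 : (0 < sg)%R by exact: powR_gt0.
      have -> : (g x * dist x `^ (- lam) =
          (sg * g x) * (sg^-1 * dist x `^ (- lam)))%R.
        by field; rewrite gt_eqF.
      apply: (le_trans (conjugate_powR _ _ t0 t'0 tt')).
      - by rewrite mulr_ge0// ltW.
      - by rewrite mulr_ge0 ?powR_ge0// invr_ge0 ltW.
      have t'1 : (1 <= t')%R by rewrite /t' ler_pdivlMr ?subr_gt0// mul1r; lra.
      apply: lerD.
        apply: (@le_trans _ _ ((sg * g x) `^ t)%R).
          by rewrite ler_pdivrMr// ler_peMr ?powR_ge0// ltW.
        rewrite powRM ?(ltW sg0)// /sg -powRrM divfK ?gt_eqF//.
      apply: (@le_trans _ _ ((sg^-1 * dist x `^ (- lam)) `^ t')%R).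
        by rewrite ler_pdivrMr// ler_peMr ?powR_ge0.
      rewrite powRM ?powR_ge0 ?invr_ge0 ?(ltW sg0)// /sg -powRN -!powRrM.
      rewrite (_ : - ((p - 1) / t) * t' = e)%R ?mulNr//.
      by rewrite /t' /e; field; rewrite !gt_eqF//= subr_gt0.
  rewrite ge0_integralD//; last 4 first.
  - by move=> x _; rewrite -EFinM lee_fin mulr_ge0// powR_ge0.
  - apply: measurable_funTS; under eq_fun do rewrite -EFinM.
    by apply/measurable_EFinP; apply: measurable_funM => //; exact: measurable_fun_powR.
  - by move=> x _; rewrite -EFinM lee_fin mulr_ge0// powR_ge0.
  - apply: measurable_funTS; under eq_fun do rewrite -EFinM.
    by apply/measurable_EFinP; apply: measurable_funM => //; exact: measurable_fun_powR.
  rewrite addeC ge0_muleDr ?lee_fin//; last first.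
    by apply: integral_ge0 => x _; rewrite lee_fin powR_ge0.
  apply: leeD.
    rewrite ge0_integralZl_EFin//; last 3 first.
    - by move=> x _; rewrite lee_fin powR_ge0.
    - by apply/measurable_funTS/measurable_EFinP; exact: measurable_fun_powR.
    - exact: powR_ge0.
    apply: (@le_trans _ _ ((F `^ e)%:E * (C2 * r `^ (N - lam * t'))%:E)).
      by rewrite lee_wpmul2l ?lee_fin ?powR_ge0//; exact: outer.
    rewrite -!EFinM lee_fin mulrCA mulrC ler_wpM2r//.
    rewrite /r -powRrM -powRD; last by apply/implyP => _; rewrite gt_eqF.
    rewrite le_eqVlt; apply/orP; left; apply/eqP; congr (_ `^ _)%R.
    by rewrite /e /t' lamE; field; rewrite !gt_eqF//= subr_gt0.
  rewrite ge0_integralZl_EFin//; last 3 first.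
  - by move=> x _; rewrite lee_fin powR_ge0.
  - by apply/measurable_funTS/measurable_EFinP; exact: measurable_fun_powR.
  - exact: powR_ge0.
  rewrite lee_wpmul2l ?lee_fin ?powR_ge0//.
  apply: ge0_subset_integral => //.
  - by apply/measurable_EFinP; exact: measurable_fun_powR.
  - by move=> x _; rewrite lee_fin powR_ge0.
apply: (le_trans (leeD near_le far_le)).
rewrite -ge0_muleDr ?lee_fin//; last first.
  by rewrite adde_ge0 ?lee_fin// integral_ge0// => x _; rewrite lee_fin powR_ge0.
by rewrite addeA EFinD.
Qed.

End truncated_potential.

(** * The bilinear estimate *)

Section bilinear.
Context d1 d2 {X : measurableType d1} {Y : measurableType d2} {R : realType}.
Local Open Scope ereal_scope.

(** Integrates one section of the truncated product.  For c = 0 the integrand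
    vanishes, whereas the bound of [truncated_potential_le], which involves
    negative powers of c, is only available for c > 0. *)
Lemma truncated_section_le {d} {T : measurableType d}
    (mu : {measure set T -> \bar R}) (dist g : T -> R) (lam p t kap C c : R) :
    measurable_fun setT dist -> measurable_fun setT g -> (forall x, 0 <= g x)%R ->
    (0 <= c)%R -> (0 < p)%R -> (0 <= C)%R ->
    ((0 < c)%R -> \int[mu]_(x in [set x | (g x <= c `^ kap)%R])
      (g x * dist x `^ (- lam))%:E
      <= (c `^ (p - 1))%:E * (C%:E + \int[mu]_x (g x `^ t)%:E)) ->
  \int[mu]_x ((fun x => (c * (g x * dist x `^ (- lam)))%:E)
      \_ [set x | (g x <= c `^ kap)%R]) x
    <= (c `^ p)%:E * (C%:E + \int[mu]_x (g x `^ t)%:E).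
Proof.
move=> mdist mg g0 c0 p0 C0 bnd; set S := [set x | _].
have mS : measurable S by exact: measurable_set_le.
have G0 : 0 <= \int[mu]_x (g x `^ t)%:E.
  by apply: integral_ge0 => x _; rewrite lee_fin powR_ge0.
rewrite -integral_mkcond.
move: c0; rewrite le_eqVlt => /predU1P[c0|c0].
  rewrite integral0_eq => [|x _]; last by rewrite -c0 mul0r.
  by apply: mule_ge0; [rewrite lee_fin powR_ge0|exact: adde_ge0].
under eq_integral do rewrite EFinM.
rewrite ge0_integralZl_EFin ?(ltW c0)//; last 2 first.
- by move=> x _; rewrite lee_fin mulr_ge0// powR_ge0.
- apply/measurable_funTS/measurable_EFinP; apply: measurable_funM => //.
  exact: measurable_fun_powR.
apply: (@le_trans _ _ (c%:E *
    ((c `^ (p - 1))%:E * (C%:E + \int[mu]_x (g x `^ t)%:E)))).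
  by rewrite lee_wpmul2l ?lee_fin ?(ltW c0)//; exact: bnd.
by rewrite muleA -EFinM mulr_powRB1// ltW.
Qed.

Variables (mu : {sigma_finite_measure set X -> \bar R})
          (nu : {sigma_finite_measure set Y -> \bar R}).

(** The product space is cut along g(x) = f(y)^kap.  Integrating in x first where
    g is below this value, and in y first where f is below g^(1/kap), Tonelli's
    theorem reduces both parts to [truncated_potential_le]. *)
Lemma bilinear_potential_le (A N M lam t p : R) (dist : X -> Y -> R) :
    (0 <= A)%R -> (0 < lam)%R -> (lam < N)%R -> (lam < M)%R ->
    (1 < t)%R -> (1 < p)%R ->
    lam = (M * (1 - p^-1) + N * (1 - t^-1))%R ->
    measurable_fun setT (fun z : X * Y => dist z.1 z.2) ->
    (forall x y, 0 <= dist x y)%R ->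
    (forall y, ball_growth mu A N (dist^~ y)) ->
    (forall x, ball_growth nu A M (dist x)) ->
  exists2 C : R, (0 <= C)%R & forall (f : Y -> R) (g : X -> R),
    measurable_fun setT f -> (forall y, 0 <= f y)%R ->
    measurable_fun setT g -> (forall x, 0 <= g x)%R ->
  \int[mu \x nu]_z (g z.1 * f z.2 * dist z.1 z.2 `^ (- lam))%:E
    <= \int[nu]_y (f y `^ p)%:E * (C%:E + \int[mu]_x (g x `^ t)%:E)
     + \int[mu]_x (g x `^ t)%:E * (C%:E + \int[nu]_y (f y `^ p)%:E).
Proof.
move=> A0 lam0 lamN lamM t1 p1 lamE mdist dist0 growX growY.
have N0 : (0 < N)%R by exact: lt_trans lamN.
have M0 : (0 < M)%R by exact: lt_trans lamM.
have [t0 p0] : (0 < t)%R /\ (0 < p)%R by split; lra.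
have [C1 C10 boundX] :=
  truncated_potential_le mu A0 N0 M0 lam0 lamN t1 p1 lamE.
have lamE' : lam = (N * (1 - t^-1) + M * (1 - p^-1))%R by rewrite addrC.
have [C2 C20 boundY] :=
  truncated_potential_le nu A0 M0 N0 lam0 lamM p1 t1 lamE'.
exists (C1 + C2)%R => [|f g mf f0 mg g0]; first exact: addr_ge0.
have mdistX y : measurable_fun setT (dist^~ y).
  exact: (measurable_fun_pair1 y mdist).
have mdistY x : measurable_fun setT (dist x).
  exact: (measurable_fun_pair2 x mdist).
pose h z := (g z.1 * f z.2 * dist z.1 z.2 `^ (- lam))%:E.
have h0 z : 0 <= h z by rewrite lee_fin !mulr_ge0// powR_ge0.
have mg1 : measurable_fun setT (fun z : X * Y => g z.1).
  exact: (measurableT_comp mg).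
have mf2 : measurable_fun setT (fun z : X * Y => f z.2).
  exact: (measurableT_comp mf).
have mh : measurable_fun setT h.
  apply/measurable_EFinP; apply: measurable_funM; last exact: measurable_fun_powR.
  exact: measurable_funM.
pose kap := (p * N / (t * M))%R; pose kap' := (t * M / (p * N))%R.
pose S := [set z : X * Y | (g z.1 <= f z.2 `^ kap)%R].
pose S' := [set z : X * Y | (f z.2 <= g z.1 `^ kap')%R].
have mS : measurable S.
  by apply: measurable_set_le => //; exact: measurable_fun_powR.
have mS' : measurable S'.
  by apply: measurable_set_le => //; exact: measurable_fun_powR.
have SS' : ~` S `<=` S'.
  move=> z /negP; rewrite -ltNge /S' /= => Sz.
  have kap'0 : (0 < kap')%R by rewrite divr_gt0// mulr_gt0.
  have -> : f z.2 = ((f z.2 `^ kap) `^ kap')%R.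
    rewrite -powRrM (_ : kap * kap' = 1)%R ?powRr1//.
    by rewrite /kap /kap'; field; rewrite !gt_eqF.
  by apply: ge0_ler_powR; rewrite ?nnegrE ?powR_ge0 ?(ltW kap'0) ?(ltW Sz).
set Fp := \int[nu]_y _; set G := \int[mu]_x _.
have Fp0 : 0 <= Fp by apply: integral_ge0 => x _; rewrite lee_fin powR_ge0.
have G0 : 0 <= G by apply: integral_ge0 => x _; rewrite lee_fin powR_ge0.
have C1G : 0 <= C1%:E + G by exact: adde_ge0.
have C2Fp : 0 <= C2%:E + Fp by exact: adde_ge0.
have near : \int[mu \x nu]_(z in S) h z <= Fp * (C1%:E + G).
  rewrite integral_mkcond fubini_tonelli2; last 2 first.
  - by apply/(measurable_restrictT _ mS); exact: measurable_funTS.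
  - by move=> z; rewrite patchE; case: ifP.
  rewrite -ge0_integralZr//; last 2 first.
  - by apply/measurable_EFinP; exact: measurable_fun_powR.
  - by move=> y _; rewrite lee_fin powR_ge0.
  apply: ge0_le_integral => //.
  - by move=> y _; apply: integral_ge0 => x _; rewrite patchE; case: ifP.
  - apply: measurable_fun_fubini_tonelli_G => //.
      by apply/(measurable_restrictT _ mS); exact: measurable_funTS.
    by move=> z; rewrite patchE; case: ifP.
  - under eq_fun do rewrite muleC.
    by apply: measurable_funeM; apply/measurable_EFinP; exact: measurable_fun_powR.
  - move=> y _; have := truncated_section_le (mdistX y) mg g0 (f0 y) p0 C10
      (boundX _ _ _ (mdistX y) (dist0^~ y) (growX y) mg g0).
    apply: le_trans.
    rewrite le_eqVlt; apply/orP; left; apply/eqP; apply: eq_integral => x _.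
    rewrite !patchE; congr (if _ then _ else _).
    by rewrite /h/= mulrAC mulrC.
have far : \int[mu \x nu]_(z in S') h z <= G * (C2%:E + Fp).
  rewrite integral_mkcond fubini_tonelli1; last 2 first.
  - by apply/(measurable_restrictT _ mS'); exact: measurable_funTS.
  - by move=> z; rewrite patchE; case: ifP.
  rewrite -ge0_integralZr//; last 2 first.
  - by apply/measurable_EFinP; exact: measurable_fun_powR.
  - by move=> y _; rewrite lee_fin powR_ge0.
  apply: ge0_le_integral => //.
  - by move=> y _; apply: integral_ge0 => x _; rewrite patchE; case: ifP.
  - apply: measurable_fun_fubini_tonelli_F => //.
      by apply/(measurable_restrictT _ mS'); exact: measurable_funTS.
    by move=> z; rewrite patchE; case: ifP.
  - under eq_fun do rewrite muleC.
    by apply: measurable_funeM; apply/measurable_EFinP; exact: measurable_fun_powR.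
  - move=> x _; have := truncated_section_le (mdistY x) mf f0 (g0 x) t0 C20
      (boundY _ _ _ (mdistY x) (dist0 x) (growY x) mf f0).
    apply: le_trans.
    rewrite le_eqVlt; apply/orP; left; apply/eqP; apply: eq_integral => y _.
    rewrite !patchE; congr (if _ then _ else _).
    by rewrite /h/= mulrA.
rewrite -(setUv S) ge0_integral_setU//; last 4 first.
- exact: measurableC.
- by rewrite setUv.
- by move=> z _; exact: h0.
- exact/disj_setPCl.
apply: leeD.
  apply: le_trans near _; rewrite lee_wpmul2l// leeD2r// lee_fin lerDl.
  exact: C20.
apply: (@le_trans _ _ (\int[mu \x nu]_(z in S') h z)).
  apply: ge0_subset_integral => //; first exact: measurableC.
    exact: measurable_funTS.
  by move=> z _; exact: h0.
by apply: le_trans far _; rewrite lee_wpmul2l// leeD2r// lee_fin lerDr.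
Qed.

End bilinear.

(** * From a bilinear estimate to a norm estimate *)

Section duality.
Context d {T : measurableType d} {R : realType}.
Variable mu : {sigma_finite_measure set T -> \bar R}.
Local Open Scope ereal_scope.

(** Testing the hypothesis on g = s v^(q-1), for which g^t = s^t v^q, gives
    s J <= c + c s^t J with J = int v^q.  For s small enough that
    c s^t = s / 2, the finite number J is absorbed on the left. *)
Lemma truncation_bound (c t q : R) : (0 < c)%R -> (1 < t)%R ->
    (t^-1 + q^-1 = 1)%R ->
  exists2 K : R, (0 <= K)%R & forall u v : T -> R,
    measurable_fun setT u -> measurable_fun setT v ->
    (forall x, 0 <= v x <= u x)%R ->
    \int[mu]_x (v x `^ q)%:E < +oo ->
    (forall g : T -> R, measurable_fun setT g -> (forall x, 0 <= g x)%R ->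
      \int[mu]_x (g x * u x)%:E
        <= c%:E * (1 + \int[mu]_x (g x `^ t)%:E)) ->
    \int[mu]_x (v x `^ q)%:E <= K%:E.
Proof.
move=> c0 t1 tq; have t0 : (0 < t)%R by lra.
have qE : (q = t / (t - 1))%R.
  apply: invr_inj; rewrite invf_div mulrBl divff ?gt_eqF// mul1r.
  by rewrite -tq addrAC subrr add0r.
have q1 : (1 < q)%R by rewrite qE ltr_pdivlMr ?subr_gt0// mul1r; lra.
have q0 : (0 < q)%R by lra.
have qt : ((q - 1) * t = q)%R.
  by rewrite qE; field; rewrite gt_eqF// subr_gt0.
pose s := ((2 * c) `^ (- (t - 1)^-1))%R.
have s0 : (0 < s)%R by rewrite powR_gt0// mulr_gt0.
have cst : (c * s `^ t = s / 2)%R.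
  rewrite -(mulr_powRB1 (ltW s0) t0) /s -powRrM mulNr mulVf ?gt_eqF ?subr_gt0//.
  by rewrite powR_inv1 ?mulr_ge0 ?(ltW c0)//; field; rewrite gt_eqF.
exists (2 * c / s)%R => [|u v mU mv vu vq H].
  by rewrite divr_ge0 ?(ltW s0)// mulr_ge0// ltW.
have v0 x : (0 <= v x)%R by have /andP[] := vu x.
pose g x := (s * v x `^ (q - 1))%R.
have g0 x : (0 <= g x)%R by rewrite mulr_ge0 ?powR_ge0// ltW.
have mg : measurable_fun setT g by apply: measurable_funM => //; exact: measurable_fun_powR.
have mvq : measurable_fun setT (fun x => (v x `^ q)%:E).
  by apply/measurable_EFinP; exact: measurable_fun_powR.
have vq0 x : 0 <= (v x `^ q)%:E by rewrite lee_fin powR_ge0.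
have gtE : \int[mu]_x (g x `^ t)%:E = (s `^ t)%:E * \int[mu]_x (v x `^ q)%:E.
  rewrite -ge0_integralZl_EFin ?powR_ge0//; apply: eq_integral => x _.
  by rewrite /g powRM ?powR_ge0 ?(ltW s0)// -powRrM qt EFinM.
have gu : s%:E * \int[mu]_x (v x `^ q)%:E <= \int[mu]_x (g x * u x)%:E.
  rewrite -ge0_integralZl_EFin ?(ltW s0)//; apply: ge0_le_integral => //.
  - by move=> x _; rewrite -EFinM lee_fin mulr_ge0 ?powR_ge0// ltW.
  - by apply: measurable_funeM.
  - by apply/measurable_EFinP; exact: measurable_funM.
  - move=> x _; rewrite -EFinM lee_fin -(mulr_powRB1 (v0 x) q0).
    rewrite /g [(v x * _)%R]mulrC mulrA ler_wpM2l ?mulr_ge0 ?powR_ge0 ?(ltW s0)//.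
    by have /andP[] := vu x.
have := le_trans gu (H g mg g0); rewrite gtE.
have : \int[mu]_x (v x `^ q)%:E \is a fin_num.
  by rewrite ge0_fin_numE// integral_ge0.
move=> /fineK <-; set J := fine _.
rewrite -!EFinM !lee_fin mulrDr mulr1 mulrA cst => sJ.
by rewrite ler_pdivlMr//; lra.
Qed.

(** The truncation min (u, k), cut off outside a set of finite measure, has a
    finite integral of q-th powers, as [truncation_bound] requires; the bound
    does not depend on k and passes to the limit by monotone convergence. *)
Lemma Lq_bound_of_duality (c t q : R) : (0 < c)%R -> (1 < t)%R ->
    (t^-1 + q^-1 = 1)%R ->
  exists2 K : R, (0 <= K)%R & forall u : T -> R,
    measurable_fun setT u -> (forall x, 0 <= u x)%R ->
    (forall g : T -> R, measurable_fun setT g -> (forall x, 0 <= g x)%R ->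
      \int[mu]_x (g x * u x)%:E
        <= c%:E * (1 + \int[mu]_x (g x `^ t)%:E)) ->
    \int[mu]_x (u x `^ q)%:E <= K%:E.
Proof.
move=> c0 t1 tq; have [K K0 trunc] := truncation_bound c0 t1 tq.
have q0 : (0 < q)%R.
  have : (t^-1 < 1)%R by rewrite invf_lt1//; lra.
  by rewrite -invr_gt0; lra.
exists K => // u mU u0 H.
have /sigma_finiteP[F [FT ndF Ffin]] := sigma_finiteT mu.
pose v (k : nat) x := (Num.min (u x) k%:R * \1_(F k) x)%R.
have mv k : measurable_fun setT (v k).
  apply: measurable_funM; first exact: measurable_minr.
  by apply: measurable_indic; have [] := Ffin k.
have v0 k x : (0 <= v k x)%R by rewrite mulr_ge0// le_min u0 ler0n.
have vu k x : (v k x <= u x)%R.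
  rewrite /v indicE; case: (_ \in _); rewrite ?mulr1 ?mulr0//.
  by rewrite ge_min lexx.
have vk k x : (v k x <= k%:R * \1_(F k) x)%R.
  by rewrite ler_wpM2r// ge_min lexx orbT.
have vfin k : \int[mu]_x (v k x `^ q)%:E < +oo.
  have [mF Foo] := Ffin k.
  apply: (@le_lt_trans _ _ (\int[mu]_x (k%:R `^ q * \1_(F k) x)%:E)).
    apply: ge0_le_integral => //.
    - by move=> x _; rewrite lee_fin powR_ge0.
    - by apply/measurable_EFinP; exact: measurable_fun_powR.
    - by apply/measurable_EFinP; apply: measurable_funM => //; exact: measurable_indic.
    - move=> x _; rewrite lee_fin.
      have := vk k x; rewrite indicE; case: (x \in F k) => /=.
        rewrite !mulr1 => vkx; apply: ge0_ler_powR => //; rewrite ?nnegrE//.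
        exact: ltW.
      rewrite !mulr0 => vkx.
      have -> : v k x = 0%R by apply/eqP; rewrite eq_le vkx v0.
      by rewrite powR0// gt_eqF.
  under eq_integral do rewrite EFinM.
  rewrite ge0_integralZl_EFin ?powR_ge0//; last first.
    by apply/measurable_EFinP; exact: measurable_indic.
  rewrite integral_indic// setIT; exact: lte_mul_pinfty.
pose G k x := (v k x `^ q)%:E.
have mG k : measurable_fun setT (G k) by apply/measurable_EFinP; exact: measurable_fun_powR.
have G0 k x : setT x -> 0 <= G k x by move=> _; rewrite lee_fin powR_ge0.
have ndG x : setT x -> {homo G^~ x : n m / (n <= m)%N >-> n <= m}.
  move=> _ n m nm; rewrite lee_fin; apply: ge0_ler_powR; rewrite ?nnegrE ?(ltW q0)//.
  apply: ler_pM => //; first by rewrite le_min u0 ler0n.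
    by rewrite le_min2// ler_nat.
  rewrite !indicE ler_nat; case: (x \in F n) / boolP => // xF.
  suff -> : x \in F m by [].
  move: xF; rewrite !inE => xF.
  by have /subsetPset := ndF _ _ nm; apply.
have limG x : limn (G^~ x) = (u x `^ q)%:E.
  apply/cvg_lim => //; apply: cvg_near_cst.
  have [i _ Fix] : (\bigcup_i F i) x by rewrite -FT.
  (* beyond this index x lies in F k and u x <= k, so the sequence is constant *)
  exists (maxn i (Num.bound (u x))) => // k /=; rewrite geq_max => /andP[ik bk].
  rewrite /G /v indicE mem_set; last first.
    by have /subsetPset := ndF _ _ ik; apply.
  rewrite mulr1 min_l//; apply: le_trans (ltW (archi_boundP (u0 x))) _.
  by rewrite ler_nat.
under eq_integral do rewrite -limG.
rewrite (monotone_convergence mu measurableT mG G0 ndG).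
apply: lime_le.
  apply: ereal_nondecreasing_is_cvgn => n m nm.
  by apply: (ge0_le_integral mu measurableT (G0 n) (mG n) (mG m)) => x _; exact: ndG.
apply: nearW => k; apply: (trunc u (v k)) => // x.
by rewrite v0 vu.
Qed.

End duality.

(** * Balls of the distance to the boundary *)

Section geometry.
Context {R : realType}.
Local Open Scope ereal_scope.

Lemma sigma_finite_halfspace m : sigma_finite setT (@lebesgue_halfspace R m).
Proof.
have [F FT Ffin] := @sigma_finite_product _ _ _ _ _ (@lebesgue_tuple R m) (@lebesgueR R).
exists F => // k; have [mF Foo] := Ffin k; split=> //.
apply: le_lt_trans Foo; rewrite /lebesgue_halfspace /mrestr.
have mh := @measurable_halfspace R m.
by apply: le_measure; rewrite ?inE//; exact: measurableI.
Qed.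

HB.instance Definition _ m := Measure_isSigmaFinite.Build _ _ _
  (@lebesgue_halfspace R m) (@sigma_finite_halfspace m).

Lemma lebesgueR_segment (a c : R) : (0 <= c)%R ->
  lebesgueR `[a, (a + c)%R]%classic = c%:E.
Proof.
move=> c0; rewrite -[LHS]/(lebesgue_measure [set` `[a, (a + c)%R]]).
rewrite lebesgue_measure_itv/= lte_fin ltrDl.
move: c0; rewrite le_eqVlt => /predU1P[<-|c0]; first by rewrite ltxx.
by rewrite c0 -EFinB addrAC subrr add0r.
Qed.

(** The corner is a sequence rather than a tuple so that dropping its first
    coordinate is a shift, which keeps inductions on the dimension simple. *)
Definition cube m (a : nat -> R) (c : R) : set (m.-tuple R) :=
  [set s | forall i : 'I_m, (a i <= tnth s i <= a i + c)%R].
Arguments cube : clear implicits.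

Lemma measurable_cube m a c : measurable (cube m a c).
Proof.
rewrite (_ : cube m a c =
    \bigcap_(i in [set: 'I_m]) ((fun s : m.-tuple R => tnth s i) @^-1` `[a i, (a i + c)%R]%classic)).
  apply: fin_bigcap_measurable => [|i _]; first exact: finite_finset.
  rewrite -[X in measurable X]setTI; apply: measurable_tnth => //.
by apply/seteqP; split=> s /= sa i; move: (sa i); rewrite /= in_itv/=; [|apply].
Qed.

Lemma lebesgue_tuple_cube m a (c : R) : (0 <= c)%R ->
  lebesgue_tuple m (cube m a c) = (c ^+ m)%:E.
Proof.
move=> c0; elim: m a => [|m IH] a.
  by rewrite /= diracE mem_set// => -[].
have preE : @tuple_cons R m @^-1` cube m.+1 a c =
    `[a 0%N, (a 0%N + c)%R]%classic `*` cube m (fun i => a i.+1) c.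
  apply/seteqP; split=> -[x s]/=.
    move=> h; split=> /=; first by have := h ord0; rewrite in_itv/= (tnth_nth 0%R).
    move=> i; have := h (lift ord0 i); rewrite !(tnth_nth 0%R)/=.
    by rewrite /bump/= add1n.
  move=> [/= + h] i; rewrite in_itv/= => x0.
  case: (unliftP ord0 i) => [j ->|->]; rewrite (tnth_nth 0%R)//=.
  by have := h j; rewrite (tnth_nth 0%R) /bump/= add1n.
have -> : lebesgue_tuple m.+1 (cube m.+1 a c) =
    (@lebesgueR R \x lebesgue_tuple m) (@tuple_cons R m @^-1` cube m.+1 a c) by [].
rewrite preE product_measure1E//; last exact: measurable_cube.
rewrite IH [X in X * _](_ : _ = c%:E); last exact: lebesgueR_segment.
by rewrite -EFinM exprS.
Qed.

Lemma bdist_ge0 m (x : m.-tuple R * R) (y : m.-tuple R) : (0 <= bdist x y)%R.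
Proof. exact: sqrtr_ge0. Qed.

Lemma bdist_ge_coord m (x : m.-tuple R * R) (y : m.-tuple R) i :
  (`|tnth x.1 i - tnth y i| <= bdist x y)%R.
Proof.
rewrite -sqrtr_sqr /bdist ler_sqrt ?sqr_ge0//; last first.
  by rewrite addr_ge0 ?sqr_ge0// sumr_ge0// => j _; rewrite sqr_ge0.
rewrite (bigD1 i)//= -addrA lerDl addr_ge0 ?sqr_ge0//.
by rewrite sumr_ge0// => j _; rewrite sqr_ge0.
Qed.

Lemma bdist_ge_height m (x : m.-tuple R * R) (y : m.-tuple R) :
  (`|x.2| <= bdist x y)%R.
Proof.
rewrite -sqrtr_sqr /bdist ler_sqrt ?sqr_ge0//; last first.
  by rewrite addr_ge0 ?sqr_ge0// sumr_ge0// => j _; rewrite sqr_ge0.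
by rewrite lerDr sumr_ge0// => j _; rewrite sqr_ge0.
Qed.

Lemma measurable_bdist m :
  measurable_fun setT (fun z : (m.-tuple R * R) * m.-tuple R => bdist z.1 z.2).
Proof.
rewrite /bdist; apply: (measurableT_comp (f := @Num.sqrt R)).
  by apply: continuous_measurable_fun; exact: sqrt_continuous.
apply: measurable_funD.
  apply: measurable_sum => i; apply: measurable_funX; apply: measurable_funB.
    by apply: (measurableT_comp (measurable_tnth i)); exact: measurableT_comp.
  exact: (measurableT_comp (measurable_tnth i)).
by apply: measurable_funX; exact: measurableT_comp.
Qed.

(** Each coordinate of a point at distance less than r from x lies within r of
    that of x, so these points lie in a cube of side 2 r. *)
Lemma ball_growth_boundary m (x : m.-tuple R * R) :
  ball_growth (lebesgue_tuple m) (2 ^+ m) m%:R (bdist x).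
Proof.
move=> r r0; rewrite powR_mulrn ?(ltW r0)// -exprMn.
rewrite -(lebesgue_tuple_cube m (fun i => nth 0 x.1 i - r)%R); last first.
  by rewrite mulr_ge0// ltW.
apply: le_measure; rewrite ?inE; last 2 first.
- exact: measurable_cube.
- move=> y /= yr i; have := le_lt_trans (@bdist_ge_coord m x y i) yr.
  rewrite -tnth_nth ltr_norml => /andP[]; lra.
apply: measurable_set_lt => //.
exact: (measurable_fun_pair2 x (@measurable_bdist m)).
Qed.

(** Here the height lies in ]0, r[, which contributes one more factor r. *)
Lemma ball_growth_halfspace m (y : m.-tuple R) :
  ball_growth (lebesgue_halfspace m) (2 ^+ m) m.+1%:R (fun x => bdist x y).
Proof.
move=> r r0; rewrite powR_mulrn ?(ltW r0)// exprSr mulrA -exprMn.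
rewrite EFinM -(lebesgue_tuple_cube m (fun i => nth 0 y i - r)%R); last first.
  by rewrite mulr_ge0// ltW.
rewrite -(lebesgueR_segment 0 (ltW r0)) add0r.
rewrite -product_measure1E; last 2 first.
- exact: measurable_cube.
- exact: measurable_itv.
rewrite [leLHS](_ : _ = (lebesgue_tuple m \x @lebesgueR R)
  ([set x | bdist x y < r]%R `&` halfspace m))//.
apply: le_measure; rewrite ?inE; last 2 first.
- by apply: measurableX; [exact: measurable_cube|exact: measurable_itv].
- move=> x [/= xr x0]; split=> /=.
    move=> i; have := le_lt_trans (@bdist_ge_coord m x y i) xr.
    rewrite -tnth_nth ltr_norml => /andP[]; lra.
  have := le_lt_trans (@bdist_ge_height m x y) xr.
  by rewrite in_itv/= ltr_norml (ltW x0) => /andP[_ /ltW].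
apply: measurableI; last exact: measurable_halfspace.
apply: measurable_set_lt => //.
exact: (measurable_fun_pair1 y (@measurable_bdist m)).
Qed.

End geometry.
Arguments cube {R} m a c.

(** * Partial integrals and Lebesgue norms *)

Section partial_integrals_and_norms.
Local Open Scope ereal_scope.

(** For a function without sign the integral is the difference of the integrals
    of its positive and negative parts, to which Tonelli's theorem applies. *)
Lemma measurable_partial_integral d1 d2 (X : measurableType d1)
    (Y : measurableType d2) (R : realType)
    (nu : {sigma_finite_measure set Y -> \bar R}) (h : X * Y -> \bar R) :
  measurable_fun setT h -> measurable_fun setT (fun x => \int[nu]_y h (x, y)).
Proof.
move=> mh.
rewrite (_ : (fun x => _) = (fun x => fubini_F nu h^\+ x - fubini_F nu h^\- x)).
  apply: emeasurable_funB; apply: measurable_fun_fubini_tonelli_F => //.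
  - exact: measurable_funepos.
  - exact: measurable_funeneg.
apply/funext => x; rewrite [LHS]integralE; congr (_ - _).
  by apply: eq_integral => y _; rewrite !funeposE.
by apply: eq_integral => y _; rewrite !funenegE.
Qed.

Lemma Lnorm_real d (T : measurableType d) (R : realType)
    (mu : {measure set T -> \bar R}) (r : R) (f : T -> R) :
  'N[mu]_(r%:E)[EFin \o f] = (\int[mu]_x (`|f x| `^ r)%:E) `^ r^-1.
Proof. by rewrite unlock. Qed.

Lemma indic_Lfun d (T : measurableType d) (R : realType)
    (mu : {measure set T -> \bar R}) (A : set T) (r : R) :
  measurable A -> mu A = 1 -> (0 < r)%R ->
  (\1_A : T -> R) \in Lfun mu r%:E /\ 'N[mu]_(r%:E)[EFin \o \1_A] = 1.
Proof.
move=> mA A1 r0.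
have N1 : 'N[mu]_(r%:E)[EFin \o \1_A] = 1.
  rewrite Lnorm_real (_ : \int[mu]_x _ = 1) ?poweR1r//.
  rewrite -A1 -[in RHS](setIT A) -(integral_indic mu measurableT mA).
  apply: eq_integral => x _ /=; rewrite indicE.
  by case: (x \in A); rewrite /= ?normr1 ?powR1// normr0 powR0// gt_eqF.
split=> //; apply/andP; split; rewrite inE/=.
  exact: measurable_indic.
by rewrite /finite_norm N1 ltry.
Qed.

Lemma Lfun_measurable d (T : measurableType d) (R : realType)
    (mu : {measure set T -> \bar R}) (r : \bar R) (f : T -> R) :
  f \in Lfun mu r -> measurable_fun setT f.
Proof. by move=> /andP[+ _]; rewrite inE. Qed.

Lemma Lfun_powR_integral d (T : measurableType d) (R : realType)
    (mu : {measure set T -> \bar R}) (r : R) (f : T -> R) :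
  (0 < r)%R -> f \in Lfun mu r%:E -> \int[mu]_x (`|f x| `^ r)%:E < +oo.
Proof.
move=> r0 /andP[_]; rewrite inE/= /finite_norm Lnorm_real.
by apply: lty_poweRy; rewrite invr_neq0// gt_eqF.
Qed.

Lemma Lfun_of_integral d (T : measurableType d) (R : realType)
    (mu : {measure set T -> \bar R}) (r : R) (f : T -> R) :
  measurable_fun setT f -> \int[mu]_x (`|f x| `^ r)%:E < +oo ->
  f \in Lfun mu r%:E.
Proof.
move=> mf foo; apply/andP; split; rewrite inE//=.
by rewrite /finite_norm Lnorm_real poweR_lty.
Qed.

Lemma Lnorm_scale d (T : measurableType d) (R : realType)
    (mu : {measure set T -> \bar R}) (r a : R) (f : T -> R) : (0 < r)%R ->
  measurable_fun setT f ->
  'N[mu]_(r%:E)[EFin \o (fun x => a * f x)%R] = `|a|%:E * 'N[mu]_(r%:E)[EFin \o f].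
Proof.
move=> r0 mf; rewrite !Lnorm_real.
under eq_integral do rewrite normrM powRM// EFinM.
rewrite ge0_integralZl_EFin ?powR_ge0//; last first.
  apply/measurable_EFinP; apply: measurable_fun_powR.
  exact: measurableT_comp.
rewrite poweRM ?lee_fin ?powR_ge0//; last first.
  by apply: integral_ge0 => x _; rewrite lee_fin powR_ge0.
by rewrite poweR_EFin -powRrM divff ?gt_eqF// powRr1.
Qed.

End partial_integrals_and_norms.

(** * The extension operator on the half space *)

Section potential.
Context {R : realType}.
Variables (m : nat) (lam p t q : R).
Hypotheses (lam0 : 0 < lam) (lamm : lam < m%:R) (t1 : 1 < t) (p1 : 1 < p).
Hypothesis lamE : lam = m%:R * (1 - p^-1) + m.+1%:R * (1 - t^-1).
Hypothesis tq : t^-1 + q^-1 = 1.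
Local Open Scope ereal_scope.
Local Notation mu := (@lebesgue_halfspace R m).
Local Notation nu := (@lebesgue_tuple R m).

Let p0 : (0 < p)%R. Proof. exact: lt_trans ltr01 p1. Qed.

Let t0 : (0 < t)%R. Proof. exact: lt_trans ltr01 t1. Qed.

Let q1 : (1 < q)%R.
Proof.
have : (q^-1 < 1)%R by rewrite -tq ltrDr invr_gt0.
by rewrite invf_lt1// -invr_gt0 -(ltrD2l t^-1) tq addr0 invf_lt1.
Qed.

Let q0 : (0 < q)%R. Proof. exact: lt_trans ltr01 q1. Qed.

Definition kernel_product (f : m.-tuple R -> R) (g : m.-tuple R * R -> R)
    (z : (m.-tuple R * R) * m.-tuple R) : \bar R :=
  (g z.1 * f z.2 / bdist z.1 z.2 `^ lam)%:E.

Definition potential (f : m.-tuple R -> R) (x : m.-tuple R * R) : \bar R :=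
  \int[nu]_y (f y / bdist x y `^ lam)%:E.

Lemma measurable_kernel_product (f : m.-tuple R -> R) (g : m.-tuple R * R -> R) :
  measurable_fun setT f -> measurable_fun setT g ->
  measurable_fun setT (kernel_product f g).
Proof.
move=> mf mg; apply/measurable_EFinP.
apply: measurable_funM.
  by apply: measurable_funM; exact: measurableT_comp.
under eq_fun do rewrite -powRN.
exact: (measurable_fun_powR _ (@measurable_bdist R m)).
Qed.

Lemma measurable_potential (f : m.-tuple R -> R) : measurable_fun setT f ->
  measurable_fun setT (potential f).
Proof.
move=> mf.
have := measurable_partial_integral nu
  (measurable_kernel_product mf (measurable_cst (1%R : R))).
apply: eq_measurable_fun => x _.
by apply: eq_integral => y _; rewrite /kernel_product/= mul1r.
Qed.

Lemma bilinear_halfspace_le :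
  exists2 C : R, (0 <= C)%R &
    forall (f : m.-tuple R -> R) (g : m.-tuple R * R -> R),
    measurable_fun setT f -> (forall y, 0 <= f y)%R ->
    measurable_fun setT g -> (forall x, 0 <= g x)%R ->
  \int[mu \x nu]_z kernel_product f g z
    <= \int[nu]_y (f y `^ p)%:E * (C%:E + \int[mu]_x (g x `^ t)%:E)
     + \int[mu]_x (g x `^ t)%:E * (C%:E + \int[nu]_y (f y `^ p)%:E).
Proof.
have A0 : (0 <= 2 ^+ m :> R)%R by rewrite exprn_ge0.
have lamm1 : (lam < m.+1%:R)%R by apply: lt_trans lamm _; rewrite ltr_nat.
have [C C0 CP] := bilinear_potential_le A0 lam0 lamm1 lamm t1 p1 lamE
  (@measurable_bdist R m) (@bdist_ge0 R m)
  (@ball_growth_halfspace R m) (@ball_growth_boundary R m).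
exists C => // f g mf f0 mg g0; apply: le_trans (CP f g mf f0 mg g0).
rewrite le_eqVlt; apply/orP; left; apply/eqP; apply: eq_integral => z _.
by rewrite /kernel_product powRN.
Qed.

Lemma abs_kernel_product f g z :
  `|kernel_product f g z| = kernel_product (Num.norm \o f) (Num.norm \o g) z.
Proof.
rewrite /kernel_product /= normrM normfV normrM.
by rewrite (ger0_norm (powR_ge0 _ _)).
Qed.

Lemma integrable_kernel_product (f : m.-tuple R -> R) (g : m.-tuple R * R -> R) :
    measurable_fun setT f -> measurable_fun setT g ->
    \int[nu]_y (`|f y| `^ p)%:E < +oo -> \int[mu]_x (`|g x| `^ t)%:E < +oo ->
  (mu \x nu).-integrable setT (kernel_product f g).
Proof.
move=> mf mg foo goo; apply/integrableP; split.
  exact: measurable_kernel_product.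
have [C C0 CP] := bilinear_halfspace_le.
under eq_integral do rewrite abs_kernel_product.
have mf' : measurable_fun setT (Num.norm \o f) by exact: measurableT_comp.
have mg' : measurable_fun setT (Num.norm \o g) by exact: measurableT_comp.
apply: le_lt_trans (CP _ _ mf' _ mg' _) _ => [y|x|] /=; rewrite ?normr_ge0//.
have Fp0 : 0 <= \int[nu]_y (`|f y| `^ p)%:E.
  by apply: integral_ge0 => y _; rewrite lee_fin powR_ge0.
have G0 : 0 <= \int[mu]_x (`|g x| `^ t)%:E.
  by apply: integral_ge0 => x _; rewrite lee_fin powR_ge0.
have /fineK <- : \int[nu]_y (`|f y| `^ p)%:E \is a fin_num by rewrite ge0_fin_numE.
have /fineK <- : \int[mu]_x (`|g x| `^ t)%:E \is a fin_num by rewrite ge0_fin_numE.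
by rewrite -!EFinD ltry.
Qed.

(** At a point x of positive height the distance to the boundary is at least
    x.2, so Young's inequality leaves the integral of a power of the distance
    over the region away from 0; that power exceeds the dimension m of the
    boundary.  Hence the potential is finite at every such x, and not only
    almost everywhere. *)
Lemma integrable_potential (f : m.-tuple R -> R) (x : m.-tuple R * R) :
    measurable_fun setT f ->
    \int[nu]_y (`|f y| `^ p)%:E < +oo -> (0 < x.2)%R ->
  nu.-integrable setT (fun y => (f y / bdist x y `^ lam)%:E).
Proof.
move=> mf foo x0; apply/integrableP.
have mb := measurable_fun_pair2 x (@measurable_bdist R m).
have mk : measurable_fun setT (fun y => (f y / bdist x y `^ lam)%:E).
  apply/measurable_EFinP; apply: measurable_funM => //.
  under eq_fun do rewrite -powRN.
  exact: measurable_fun_powR.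
split => //.
have p'0 : (0 < p / (p - 1))%R by rewrite divr_gt0// subr_gt0.
set p' := (p / (p - 1))%R in p'0.
have pp' : (p^-1 + p'^-1 = 1)%R.
  by rewrite /p'; field; rewrite !gt_eqF//= subr_gt0.
have p'1 : (1 <= p')%R by rewrite /p' ler_pdivlMr ?subr_gt0// mul1r gerBl.
have A0 : (0 <= 2 ^+ m :> R)%R by rewrite exprn_ge0.
have mlam : (m%:R < lam * p')%R.
  rewrite -ltr_pdivrMr// (_ : p'^-1 = 1 - p^-1)%R; last by rewrite -pp' addrAC subrr add0r.
  by rewrite lamE ltrDl mulr_gt0// subr_gt0 invf_lt1// (lt_trans ltr01 t1).
have [C C0 outer] := outer_integral nu A0 (ler0n R m) mlam.
have far : [set y | (x.2 <= bdist x y)%R] = setT.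
  apply/seteqP; split=> // y _ /=.
  by apply: le_trans (bdist_ge_height x y); exact: ler_norm.
have := outer (bdist x) x.2 mb (bdist_ge0 x) (ball_growth_boundary x) x0.
rewrite far => bnd.
apply: (@le_lt_trans _ _ (\int[nu]_y
    ((`|f y| `^ p)%:E + (bdist x y `^ (- (lam * p')))%:E))).
  apply: ge0_le_integral => //.
  - exact: measurableT_comp.
  - apply: emeasurable_funD; apply/measurable_EFinP; apply: measurable_fun_powR => //.
    exact: measurableT_comp.
  - move=> y _; rewrite -EFinD abse_EFin lee_fin normrM normfV.
    rewrite (ger0_norm (powR_ge0 _ _)) -powRN.
    apply: (le_trans (conjugate_powR _ _ p0 p'0 pp')) => //; first exact: powR_ge0.
    apply: lerD; first by rewrite ler_pdivrMr// ler_peMr ?powR_ge0// ltW.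
    by rewrite -powRrM mulNr ler_pdivrMr// ler_peMr ?powR_ge0.
rewrite ge0_integralD//; last 3 first.
- by apply/measurable_EFinP; apply: measurable_fun_powR; exact: measurableT_comp.
- by move=> y _; rewrite lee_fin powR_ge0.
- by apply/measurable_EFinP; exact: measurable_fun_powR.
by apply: lte_add_pinfty => //; apply: le_lt_trans bnd _; rewrite ltry.
Qed.

Lemma ae_halfspace : {ae mu, forall x, (0 < x.2)%R}.
Proof.
exists (~` halfspace m); split.
- by apply: measurableC; exact: measurable_halfspace.
- by rewrite /lebesgue_halfspace /mrestr setICl measure0.
- by move=> x /= hx; exact: hx.
Qed.

Lemma potential_fin_num (f : m.-tuple R -> R) (x : m.-tuple R * R) :
    measurable_fun setT f ->
    \int[nu]_y (`|f y| `^ p)%:E < +oo -> (0 < x.2)%R ->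
  potential f x \is a fin_num.
Proof.
move=> mf foo x0; apply/integrable_fin_num => //.
exact: integrable_potential.
Qed.

Lemma abs_potential_le (f : m.-tuple R -> R) (x : m.-tuple R * R) :
    measurable_fun setT f ->
    \int[nu]_y (`|f y| `^ p)%:E < +oo -> (0 < x.2)%R ->
  `|potential f x| <= potential (Num.norm \o f) x.
Proof.
move=> mf foo x0.
have mk := measurable_int _ (integrable_potential mf foo x0).
apply: le_trans (le_abse_integral nu measurableT mk) _.
rewrite le_eqVlt; apply/orP; left; apply/eqP; apply: eq_integral => y _ /=.
by rewrite normrM normfV (ger0_norm (powR_ge0 _ _)).
Qed.

Lemma measurable_fine_potential (f : m.-tuple R -> R) : measurable_fun setT f ->
  measurable_fun setT (fine \o potential f).
Proof.
move=> mf; apply: (measurableT_comp (f := fine)).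
  exact: fine_measurable.
exact: measurable_potential.
Qed.

Lemma Lnorm_fine_potential (f : m.-tuple R -> R) : measurable_fun setT f ->
    \int[nu]_y (`|f y| `^ p)%:E < +oo ->
  'N[mu]_(q%:E)[EFin \o (fine \o potential f)] = 'N[mu]_(q%:E)[potential f].
Proof.
move=> mf foo; rewrite unlock; congr (_ `^ _).
apply: ae_eq_integral => //.
- apply: (measurableT_comp (measurable_poweR _)).
  apply: measurableT_comp => //; apply/measurable_EFinP.
  exact: measurable_fine_potential.
- apply: (measurableT_comp (measurable_poweR _)).
  by apply: measurableT_comp => //; exact: measurable_potential.
- apply: filterS ae_halfspace => x x0 _ /=.
  rewrite -[in RHS](fineK (x := potential f x))//.
  exact: potential_fin_num.
Qed.

(** Boundedness of the operator: with int |f|^p = 1 the bilinear estimate becomes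
    the hypothesis of [Lq_bound_of_duality] for the potential of |f|. *)
Lemma potential_norm_bounded : exists K : R,
  forall f : m.-tuple R -> R, measurable_fun setT f ->
    \int[nu]_y (`|f y| `^ p)%:E = 1 ->
  'N[mu]_(q%:E)[potential f] <= K%:E.
Proof.
have [C C0 CP] := bilinear_halfspace_le.
pose c := (2 * C + 2)%R.
have c0 : (0 < c)%R by rewrite ltr_wpDl// mulr_ge0.
have [K K0 dual] := Lq_bound_of_duality mu c0 t1 tq.
exists (K `^ q^-1)%R => f mf f1.
have foo : \int[nu]_y (`|f y| `^ p)%:E < +oo by rewrite f1 ltry.
have mf' : measurable_fun setT (Num.norm \o f) by exact: measurableT_comp.
have foo' : \int[nu]_y (`|(Num.norm \o f) y| `^ p)%:E < +oo.
  by under eq_integral do rewrite /= normr_id.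
rewrite -Lnorm_fine_potential// Lnorm_real -poweR_EFin.
have I0 : 0 <= \int[mu]_x (`|(fine \o potential f) x| `^ q)%:E.
  by apply: integral_ge0 => x _; rewrite lee_fin powR_ge0.
apply: gt0_ler_poweR; first by rewrite invr_ge0 ltW.
- by rewrite in_itv/= I0 leey.
- by rewrite in_itv/= lee_fin K0 leey.
pose u := fine \o potential (Num.norm \o f).
have mU : measurable_fun setT u by exact: measurable_fine_potential.
have pot0 x : 0 <= potential (Num.norm \o f) x.
  by apply: integral_ge0 => y _; rewrite lee_fin divr_ge0 ?powR_ge0//=.
have u0 x : (0 <= u x)%R by rewrite fine_ge0.
apply: (@le_trans _ _ (\int[mu]_x (u x `^ q)%:E)).
  apply: ae_ge0_le_integral => //.
  - apply/measurable_EFinP; apply: measurable_fun_powR; apply: measurableT_comp => //.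
    exact: measurable_fine_potential.
  - by move=> x _; rewrite lee_fin powR_ge0.
  - by apply/measurable_EFinP; exact: measurable_fun_powR.
  apply: filterS ae_halfspace => x x0 _ /=.
  rewrite lee_fin; apply: ge0_ler_powR; rewrite ?nnegrE ?(ltW q0)//.
  rewrite -lee_fin -abse_EFin !fineK.
  - exact: abs_potential_le.
  - exact: potential_fin_num.
  - exact: potential_fin_num.
apply: dual => // g mg g0.
have G0 : 0 <= \int[mu]_x (g x `^ t)%:E.
  by apply: integral_ge0 => x _; rewrite lee_fin powR_ge0.
apply: (@le_trans _ _ (\int[mu \x nu]_z kernel_product (Num.norm \o f) g z)).
  rewrite fubini_tonelli1; last 2 first.
  - exact: measurable_kernel_product.
  - by move=> z; rewrite lee_fin divr_ge0 ?powR_ge0// mulr_ge0//=.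
  apply: ge0_le_integral => //.
  - by move=> x _; rewrite lee_fin mulr_ge0.
  - by apply/measurable_EFinP; exact: measurable_funM.
  - exact: (measurable_partial_integral nu (measurable_kernel_product mf' mg)).
  (* [fine] sends an infinite value to 0, so the bound holds at every x,
     including those outside the half space *)
  move=> x _; rewrite /fubini_F/=.
  rewrite (_ : \int[nu]_y _ = (g x)%:E * potential (Num.norm \o f) x).
    rewrite EFinM lee_wpmul2l ?lee_fin// /u/=.
    by case: (potential _ x) (pot0 x) => //= r; rewrite ?lee_fin// leey.
  rewrite -ge0_integralZl_EFin//; last 2 first.
  - by move=> y _; rewrite lee_fin divr_ge0 ?powR_ge0//=.
  - apply/measurable_EFinP; apply: measurable_funM => //.
    under eq_fun do rewrite -powRN.
    by apply: measurable_fun_powR; exact: (measurable_fun_pair2 x (@measurable_bdist R m)).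
  by apply: eq_integral => y _; rewrite /kernel_product -EFinM/= mulrA.
apply: le_trans (CP _ _ mf' _ mg g0) _ => [y|]; first exact: normr_ge0.
rewrite [X in X * _ + _](_ : _ = 1)//= mul1e.
rewrite (_ : \int[nu]_y _ = 1)//.
move: G0; case: (\int[mu]_x _) => [G| |]//; last first.
  by move=> _; rewrite [leRHS](_ : _ = +oo) ?leey// addey// gt0_muley// lte_fin.
rewrite lee_fin => G0.
by rewrite -!(EFinD, EFinM) lee_fin /c; nra.
Qed.

Definition potential_form (f : m.-tuple R -> R) (g : m.-tuple R * R -> R) :=
  \int[mu]_x \int[nu]_y kernel_product f g (x, y).

Lemma potential_formE (f : m.-tuple R -> R) (g : m.-tuple R * R -> R) :
    measurable_fun setT f -> measurable_fun setT g ->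
    \int[nu]_y (`|f y| `^ p)%:E < +oo ->
  potential_form f g = \int[mu]_x (g x * fine (potential f x))%:E.
Proof.
move=> mf mg foo; apply: ae_eq_integral => //.
- exact: (measurable_partial_integral nu (measurable_kernel_product mf mg)).
- apply/measurable_EFinP; apply: measurable_funM => //.
  exact: measurable_fine_potential.
apply: filterS ae_halfspace => x x0 _.
rewrite EFinM fineK; last exact: potential_fin_num.
rewrite -integralZl//; last exact: integrable_potential.
by apply: eq_integral => y _; rewrite /kernel_product -EFinM/= mulrA.
Qed.

Lemma potential_form_le (f : m.-tuple R -> R) (g : m.-tuple R * R -> R) :
    measurable_fun setT f -> measurable_fun setT g ->
    \int[nu]_y (`|f y| `^ p)%:E < +oo ->
  potential_form f g <= 'N[mu]_(q%:E)[potential f] * 'N[mu]_(t%:E)[EFin \o g].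
Proof.
move=> mf mg foo; have mF := measurable_fine_potential mf.
rewrite potential_formE// muleC -(Lnorm_fine_potential mf foo).
apply: le_trans (hoelder mu mg mF t0 q0 tq).
rewrite Lnorm1; apply: le_trans (le_abse_integral mu measurableT _); last first.
  by apply/measurable_EFinP; exact: measurable_funM.
exact: lee_abs.
Qed.

(** The equality case of Hoelder's inequality.  The factor |F|^(q-2) may have a
    negative exponent, but it is multiplied by F, which vanishes where
    [powR] takes its default value. *)
Lemma potential_form_norming (f : m.-tuple R -> R) :
    measurable_fun setT f -> \int[nu]_y (`|f y| `^ p)%:E < +oo ->
    'N[mu]_(q%:E)[potential f] < +oo ->
  exists2 g : m.-tuple R * R -> R, g \in Lfun mu t%:E &
    potential_form f g = 'N[mu]_(q%:E)[potential f] * 'N[mu]_(t%:E)[EFin \o g] /\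
    'N[mu]_(t%:E)[EFin \o g] = 'N[mu]_(q%:E)[potential f] `^ (q - 1).
Proof.
move=> mf foo; rewrite -(Lnorm_fine_potential mf foo).
set F := fine \o potential f => Foo.
have mF : measurable_fun setT F := measurable_fine_potential mf.
have qt : ((q - 1) * t = q)%R.
  have tE : (t^-1 = 1 - q^-1)%R by rewrite -tq addrK.
  apply: (mulIf (x := t^-1)%R); first by rewrite invr_neq0// gt_eqF.
  by rewrite mulfK ?gt_eqF// tE mulrBr mulr1 divff// gt_eqF.
have qB1 : (0 < q - 1)%R by rewrite subr_gt0.
pose g x := (F x * `|F x| `^ (q - 2))%R.
have qB2 : (q - 2 = q - 1 - 1)%R by rewrite -addrA -opprD.
have absg x : (`|g x| = `|F x| `^ (q - 1))%R.
  by rewrite /g normrM (ger0_norm (powR_ge0 _ _)) qB2 mulr_powRB1.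
have mg : measurable_fun setT g.
  by apply: measurable_funM => //; apply: measurable_fun_powR; exact: measurableT_comp.
have gt : \int[mu]_x (`|g x| `^ t)%:E = \int[mu]_x (`|F x| `^ q)%:E.
  by apply: eq_integral => x _; rewrite absg -powRrM qt.
have I0 : 0 <= \int[mu]_x (`|F x| `^ q)%:E.
  by apply: integral_ge0 => x _; rewrite lee_fin powR_ge0.
have Ioo : \int[mu]_x (`|F x| `^ q)%:E < +oo.
  move: Foo; rewrite Lnorm_real; apply: lty_poweRy.
  by rewrite invr_neq0// gt_eqF.
have Ng : 'N[mu]_(t%:E)[EFin \o g] = 'N[mu]_(q%:E)[EFin \o F] `^ (q - 1).
  rewrite !Lnorm_real gt -poweRrM; congr (_ `^ _).
  have -> : (q - 1 = q / t)%R by rewrite -[X in (X / t)%R]qt mulfK// gt_eqF.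
  by rewrite mulKf// gt_eqF.
exists g; first by apply: Lfun_of_integral => //; rewrite gt.
split => //; rewrite potential_formE//.
rewrite (_ : \int[mu]_x _ = \int[mu]_x (`|F x| `^ q)%:E); last first.
  apply: eq_integral => x _; congr (_%:E).
  rewrite -(mulr_powRB1 (normr_ge0 (F x)) q0) -absg.
  rewrite -normrM ger0_norm; first by rewrite mulrC.
  by rewrite /g mulrA mulr_ge0 ?powR_ge0// -expr2 sqr_ge0.
have NF0 : 0 <= 'N[mu]_(q%:E)[EFin \o F] by exact: Lnorm_ge0.
have NF : 'N[mu]_(q%:E)[EFin \o F] \is a fin_num by rewrite ge0_fin_numE.
rewrite Ng -(fineK NF) poweR_EFin -EFinM mulr_powRB1 ?fine_ge0//.
rewrite -poweR_EFin fineK// Lnorm_real -poweRrM mulVf ?gt_eqF// poweRe1//.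
Qed.

Definition potential_constant : \bar R :=
  ereal_sup [set 'N[mu]_(q%:E)[potential f] | f in [set f : m.-tuple R -> R |
    f \in Lfun nu p%:E /\ 'N[nu]_(p%:E)[EFin \o f] = 1]].

Let norm1_integral (f : m.-tuple R -> R) :
  'N[nu]_(p%:E)[EFin \o f] = 1 -> \int[nu]_y (`|f y| `^ p)%:E = 1.
Proof.
move=> f1; rewrite -[RHS](poweR1r p) -f1 poweR_Lnorm ?gt_eqF//.
Qed.

(** Nonnegative functions of norm 1.  They show that the supremum defining the
    constant is over a nonempty set, and that a constant admissible in the
    inequality is nonnegative. *)
Lemma unit_cube_Lfun : exists f : m.-tuple R -> R,
  [/\ f \in Lfun nu p%:E, 'N[nu]_(p%:E)[EFin \o f] = 1 & forall y, (0 <= f y)%R].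
Proof.
have c1 : nu (cube m (fun=> 0%R) 1%R) = 1.
  by rewrite (lebesgue_tuple_cube _ _ ler01) expr1n.
have [fL f1] := indic_Lfun (@measurable_cube R m (fun=> 0%R) 1%R) c1 p0.
by exists (\1_(cube m (fun=> 0%R) 1%R)); split.
Qed.

Lemma unit_box_Lfun : exists g : m.-tuple R * R -> R,
  [/\ g \in Lfun mu t%:E, 'N[mu]_(t%:E)[EFin \o g] = 1 & forall x, (0 <= g x)%R].
Proof.
(* Heights between 1 and 2 keep the whole box inside the half space. *)
pose B : set (m.-tuple R * R) := cube m (fun=> 0%R) 1%R `*` `[1%R, (1 + 1)%R]%classic.
have mB : measurable B.
  by apply: measurableX; [exact: measurable_cube|exact: measurable_itv].
have B1 : mu B = 1.
  have -> : mu B = (nu \x @lebesgueR R) (B `&` halfspace m) by [].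
  rewrite (_ : B `&` _ = B); last first.
    apply/setIidPl => -[x s] [_ /=]; rewrite in_itv/= => /andP[s1 _].
    exact: lt_le_trans ltr01 s1.
  rewrite product_measure1E; last 2 first.
  - exact: measurable_cube.
  - exact: measurable_itv.
  rewrite [X in X * _](_ : _ = 1); last first.
    by rewrite -[RHS](congr1 EFin (expr1n R m)); exact: lebesgue_tuple_cube.
  by rewrite mul1e; exact: (lebesgueR_segment 1 ler01).
have [gL g1] := indic_Lfun mB B1 t0.
by exists (\1_B); split.
Qed.

Lemma potential_constant_ge0 : 0 <= potential_constant.
Proof.
have [f [fL f1 _]] := unit_cube_Lfun.
apply: (@le_trans _ _ 'N[mu]_(q%:E)[potential f]); first exact: Lnorm_ge0.
by apply: ereal_sup_ubound; exists f.
Qed.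

Lemma potential_constant_fin_num : potential_constant \is a fin_num.
Proof.
rewrite ge0_fin_numE ?potential_constant_ge0//.
have [K KP] := potential_norm_bounded.
apply: (@le_lt_trans _ _ K%:E); last exact: ltry.
apply: ub_ereal_sup => _ [f [fL f1] <-]; apply: KP.
  exact: Lfun_measurable fL.
exact: norm1_integral.
Qed.

(** The norm a of f is moved from f to g, which leaves the form unchanged; f / a
    then has norm 1 and its potential is bounded by the supremum. *)
Lemma potential_form_le_constant f g :
  f \in Lfun nu p%:E -> g \in Lfun mu t%:E ->
  potential_form f g
    <= potential_constant * 'N[nu]_(p%:E)[EFin \o f] * 'N[mu]_(t%:E)[EFin \o g].
Proof.
move=> fL gL; have mf := Lfun_measurable fL; have mg := Lfun_measurable gL.
have foo := Lfun_powR_integral p0 fL.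
have Nf0 : 0 <= 'N[nu]_(p%:E)[EFin \o f] by exact: Lnorm_ge0.
have Nfoo : 'N[nu]_(p%:E)[EFin \o f] \is a fin_num.
  by rewrite ge0_fin_numE// Lnorm_real poweR_lty.
have [f0|f0] := eqVneq ('N[nu]_(p%:E)[EFin \o f]) 0.
  rewrite f0 mule0 mul0e (potential_formE mf mg foo).
  have fae : EFin \o f = \0 %[ae nu].
    by apply: Lnorm_eq0_eq0 f0 => //; apply/measurable_EFinP.
  rewrite integral0_eq// => x _; rewrite (_ : potential f x = 0) ?mulr0//.
  rewrite -(integral0 nu setT); apply: ae_eq_integral => //.
    have mb := measurable_fun_pair2 x (@measurable_bdist R m).
    apply/measurable_EFinP; apply: measurable_funM => //.
    under eq_fun do rewrite -powRN.
    exact: (measurableT_comp (measurable_powR _) mb).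
  by apply: filterS fae => y + _ => /(_ I) /= [->]; rewrite mul0r.
pose a := fine ('N[nu]_(p%:E)[EFin \o f]).
have a0 : (0 < a)%R by rewrite fine_gt0// lt0e f0 Nf0 -ge0_fin_numE.
have aE : 'N[nu]_(p%:E)[EFin \o f] = a%:E by rewrite fineK.
pose f1 y := (a^-1 * f y)%R; pose ag x := (a * g x)%R.
have mf1 : measurable_fun setT f1 by exact: measurable_funM.
have mag : measurable_fun setT ag by exact: measurable_funM.
have Nf1 : 'N[nu]_(p%:E)[EFin \o f1] = 1.
  rewrite Lnorm_scale// aE -EFinM ger0_norm ?invr_ge0 ?(ltW a0)//.
  by rewrite mulVf// gt_eqF.
have f1oo : \int[nu]_y (`|f1 y| `^ p)%:E < +oo by rewrite norm1_integral// ltry.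
have -> : potential_form f g = potential_form f1 ag.
  apply: eq_integral => x _; apply: eq_integral => y _.
  rewrite /kernel_product/= /f1 /ag; congr (_ / _)%:E.
  by rewrite mulrACA mulfV ?gt_eqF// mul1r.
apply: (le_trans (potential_form_le mf1 mag f1oo)).
rewrite Lnorm_scale// ger0_norm ?(ltW a0)// aE -muleA.
rewrite lee_wpmul2r ?mule_ge0 ?lee_fin ?(ltW a0) ?Lnorm_ge0//.
apply: ereal_sup_ubound; exists f1 => //; split=> //.
exact: Lfun_of_integral.
Qed.

(** Dividing the inequality for the norming function g of f by the norm of g
    bounds the norm of the potential of f by C.  When the potential vanishes,
    the claim is C >= 0, and the inequality is tested on the two indicator
    functions of norm 1. *)
Lemma potential_constant_le (C : R) :
  (forall f g, f \in Lfun nu p%:E -> g \in Lfun mu t%:E ->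
    potential_form f g
      <= C%:E * 'N[nu]_(p%:E)[EFin \o f] * 'N[mu]_(t%:E)[EFin \o g]) ->
  potential_constant <= C%:E.
Proof.
move=> HC.
have C0 : 0 <= C%:E.
  have [f [fL f1 f0]] := unit_cube_Lfun; have [g [gL g1 g0]] := unit_box_Lfun.
  have := HC f g fL gL; rewrite f1 g1 !mule1; apply: le_trans.
  apply: integral_ge0 => x _; apply: integral_ge0 => y _.
  by rewrite lee_fin divr_ge0 ?powR_ge0// mulr_ge0.
apply: ub_ereal_sup => _ [f [fL f1] <-].
have mf := Lfun_measurable fL; have foo := Lfun_powR_integral p0 fL.
have Noo : 'N[mu]_(q%:E)[potential f] < +oo.
  apply: le_lt_trans (_ : potential_constant < +oo).
    by apply: ereal_sup_ubound; exists f.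
  by rewrite -ge0_fin_numE ?potential_constant_ge0// potential_constant_fin_num.
have N0 : 0 <= 'N[mu]_(q%:E)[potential f] by exact: Lnorm_ge0.
have [->//|Nn0] := eqVneq ('N[mu]_(q%:E)[potential f]) 0.
have [g gL [formE Ng]] := potential_form_norming mf foo Noo.
have := HC f g fL gL; rewrite formE f1 mule1 lee_pmul2r//.
- by rewrite Ng fin_num_poweR// ge0_fin_numE.
- by rewrite Ng poweR_gt0// lt0e Nn0.
Qed.

End potential.

Theorem theorem1p2 (R : realType) (n : nat) (alpha t p : R)
    (halpha : 1 < alpha < n%:R) (ht : 1 < t) (hp : 1 < p)
    (htp : (n%:R - 1) / n%:R * p^-1 + t^-1 + (n%:R - alpha + 1) / n%:R = 2) :
  [/\ extension_constant n alpha p \is a fin_num,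
      (forall (f : n.-1.-tuple R -> R) (g : n.-1.-tuple R * R -> R),
        f \in Lfun (lebesgue_tuple n.-1) p%:E ->
        g \in Lfun (lebesgue_halfspace n.-1) t%:E ->
        (lebesgue_halfspace n.-1 \x lebesgue_tuple n.-1)%E.-integrable setT
          (fun z => (g z.1 * f z.2 / bdist z.1 z.2 `^ (n%:R - alpha))%:E) /\
        (halfspace_form n alpha f g <=
          extension_constant n alpha p
          * 'N[lebesgue_tuple n.-1]_(p%:E)[EFin \o f]
          * 'N[lebesgue_halfspace n.-1]_(t%:E)[EFin \o g])%E) &
      (forall C : R,
        (forall (f : n.-1.-tuple R -> R) (g : n.-1.-tuple R * R -> R),
          f \in Lfun (lebesgue_tuple n.-1) p%:E ->
          g \in Lfun (lebesgue_halfspace n.-1) t%:E ->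
          (halfspace_form n alpha f g <=
            C%:E * 'N[lebesgue_tuple n.-1]_(p%:E)[EFin \o f]
            * 'N[lebesgue_halfspace n.-1]_(t%:E)[EFin \o g])%E) ->
        (extension_constant n alpha p <= C%:E)%E)].
Proof.
(* In dimension n = m + 1 the boundary is R^m, and lam < m since 1 < alpha. *)
case: n halpha htp => [|m] /andP[alpha1 alphan] htp; first by exfalso; lra.
set lam := m.+1%:R - alpha; set q := extension_exponent m.+1 alpha p.
have lam0 : 0 < lam by rewrite subr_gt0.
have mE : m.+1%:R = m%:R + 1 :> R by rewrite -natr1.
have lamm : lam < m%:R by rewrite /lam mE ltrBlDr ltrD2l.
have m0 : 0 < m%:R :> R by exact: lt_trans lamm.
have n0 : 0 < m.+1%:R :> R by rewrite mE addr_gt0.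
have p0 : 0 < p by exact: lt_trans hp.
have t0 : 0 < t by exact: lt_trans ht.
have tE : t^-1 = 2 - m%:R / m.+1%:R * p^-1 - (lam + 1) / m.+1%:R.
  by rewrite -htp (_ : m%:R = m.+1%:R - 1) ?mE ?addrK// -mE /lam; ring.
have lamE : lam = m%:R * (1 - p^-1) + m.+1%:R * (1 - t^-1).
  by rewrite tE mE; field; rewrite -mE !gt_eqF.
have tq : t^-1 + q^-1 = 1.
  rewrite /q /extension_exponent invrK tE /lam mE addrK.
  by field; rewrite -mE !gt_eqF.
split.
- exact: (potential_constant_fin_num lam0 lamm ht hp lamE tq).
- move=> f g fL gL; split.
    apply: (integrable_kernel_product lam0 lamm ht hp lamE).
    + exact: Lfun_measurable fL.
    + exact: Lfun_measurable gL.
    + exact: Lfun_powR_integral fL.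
    + exact: Lfun_powR_integral gL.
  exact: (potential_form_le_constant ht hp lamE tq fL gL).
- move=> C HC; exact: (potential_constant_le lam0 lamm ht hp lamE tq HC).
Qed.
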